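(* Let $M=(X,d)$ be a metric space with $\eta(M)>0$, and let $M'$ be a metric space. Then the lexicographic metric space $M\circ M'$ is compact if and only if $X$ is finite and $M'$ is compact.
   Context: All metric spaces are nonempty. For a metric space $M=(X,d)$ and $x\in X$, the nearness of $x$ is $\eta(x)=\inf\{d(x,y): y\in X\setminus\{x\}\}$ and the nearness of $M$ is $\eta(M)=\inf\{\eta(x): x\in X\}$ (with $\inf\emptyset=+\infty$). If $M=(X,d)$ and $M'=(Y,d_Y)$ are metric spaces with $\eta(M)>0$, the lexicographic metric space is $M\circ M'=(X\times Y,\rho)$, where $\rho((x,y),(x',y'))=d(x,x')$ if $x\neq x'$, and $\rho((x,y),(x',y'))=\min\{2\eta(x),d_Y(y,y')\}$ if $x=x'$; $\rho$ is a metric. *)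

(* Defs.v *)
From HB Require Import structures.
From mathcomp Require Import all_boot all_order all_algebra.
From mathcomp Require Import all_classical all_reals all_analysis.

Set Implicit Arguments.
Unset Strict Implicit.
Unset Printing Implicit Defensive.

Import Order.TTheory GRing.Theory Num.Theory.

Local Open Scope classical_set_scope.
Local Open Scope ring_scope.

Section Nearness.
Context {R : realType}.
Local Open Scope ereal_scope.

(* Both infima are taken in \bar R, where ereal_inf set0 = +oo. *)
Definition nearness_at (X : metricType R) (x : X) : \bar R :=
  ereal_inf [set (mdist x y)%:E | y in ~` [set x]].

Definition nearness (X : metricType R) : \bar R :=
  ereal_inf (range (@nearness_at X)).

Lemma nearness_at_gt0 (X : metricType R) (x : X) :
  0 < nearness X -> 0 < nearness_at x.
Proof.
by move=> /lt_le_trans; apply; apply: ereal_inf_lbound; exists x.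
Qed.

Lemma nearness_at_le (X : metricType R) (x y : X) :
  x != y -> nearness_at x <= (mdist x y)%:E.
Proof.
move=> xy; apply: ereal_inf_lbound; exists y => //= yx.
by rewrite yx eqxx in xy.
Qed.

End Nearness.

(* The underlying set of the lexicographic metric space.  The hypothesis on X
   is a parameter of the type because the metric below depends on it; the alias
   also hides the product metric that X * Y carries in the library. *)
Definition lexicographic {R : realType} {X : metricType R} (Y : metricType R)
  (etaX : (0 < nearness X)%E) : Type := (X * Y)%type.

Section LexicographicMetric.
Context {R : realType} {X Y : metricType R}.

(* The minimum is computed in \bar R, as nearness_at p.1 = +oo when X is a
   singleton; it is always finite, so that fine loses nothing. *)
Definition lexicographic_dist (p q : X * Y) : R :=
  if p.1 == q.1
  then fine (Order.min (2%:E * nearness_at p.1) (mdist p.2 q.2)%:E)%E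
  else mdist p.1 q.1.

Context (etaX : (0 < nearness X)%E).

Let distxx (p : X * Y) : lexicographic_dist p p = 0.
Proof.
rewrite /lexicographic_dist eqxx mdistxx min_r//.
by rewrite mule_ge0// ltW// nearness_at_gt0.
Qed.

Let radius_gt0 (x : X) : (0 < 2%:E * nearness_at x)%E.
Proof. by rewrite mule_gt0// nearness_at_gt0. Qed.

Let radius_le (x y : X) :
  x != y -> (2%:E * nearness_at x <= (2 * mdist x y)%:E)%E.
Proof. by move=> xy; rewrite EFinM lee_pmul2l// nearness_at_le. Qed.

Let dist_positivity (p q : X * Y) : lexicographic_dist p q = 0 -> p = q.
Proof.
case: p q => [x y] [x' y']; rewrite /lexicographic_dist /=.
case: eqVneq => [<-|xx'] d0; last first.
  by move: xx'; rewrite (mdist_positivity _ _ d0) eqxx.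
congr pair; apply: mdist_positivity; move: d0 (radius_gt0 x).
case: (2%:E * nearness_at x)%E => [c||]//=.
rewrite lte_fin -EFin_min /=; case: (leP c (mdist y y')) => // _ ->.
by rewrite ltxx.
Qed.

Let dist_sym (p q : X * Y) : lexicographic_dist p q = lexicographic_dist q p.
Proof.
case: p q => [x y] [x' y']; rewrite /lexicographic_dist /= eq_sym.
by case: eqVneq => [->|_]; [rewrite (metric_sym y)|rewrite metric_sym].
Qed.

Let dist_ge0 (p q : X * Y) : 0 <= lexicographic_dist p q.
Proof.
rewrite /lexicographic_dist; case: ifP => _; last exact: mdist_ge0.
apply: fine_ge0; rewrite le_min lee_fin mdist_ge0 andbT.
by rewrite mule_ge0// ltW// nearness_at_gt0.
Qed.

Let dist_triangle (q p r : X * Y) :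
  lexicographic_dist p r <= lexicographic_dist p q + lexicographic_dist q r.
Proof.
have [pq|pq] := eqVneq p.1 q.1; last first.
  have [pr|pr] := eqVneq p.1 r.1.
    rewrite /lexicographic_dist -pr eqxx (negbTE pq) eq_sym (negbTE pq).
    rewrite (metric_sym q.1) -mulr2n -(mulr_natl (mdist p.1 q.1)).
    move: (radius_gt0 p.1) (radius_le pq).
    case: (2%:E * nearness_at p.1)%E => [c||]//; rewrite lte_fin lee_fin => c0 cle.
    by rewrite -EFin_min /= ge_min cle.
  have [qr|qr] := eqVneq q.1 r.1.
    rewrite {1 2}/lexicographic_dist (negbTE pr) (negbTE pq) qr.
    by rewrite lerDl dist_ge0.
  rewrite /lexicographic_dist (negbTE pr) (negbTE pq) (negbTE qr).
  exact: metric_triangle.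
have [qr|qr] := eqVneq q.1 r.1; last first.
  rewrite {1 3}/lexicographic_dist pq (negbTE qr).
  by rewrite lerDr dist_ge0.
rewrite /lexicographic_dist pq qr eqxx.
have tri := metric_triangle p.2 q.2 r.2.
move: (mdist_ge0 p.2 q.2) (mdist_ge0 q.2 r.2).
move: (radius_gt0 r.1); case: (2%:E * nearness_at r.1)%E => [c||]//.
rewrite lte_fin -!EFin_min /= => c0 a0 b0.
rewrite ge_min; case: (leP c (mdist p.2 q.2)) => h1.
  by rewrite lerDl le_min b0 (ltW c0).
case: (leP c (mdist q.2 r.2)) => h2; first by rewrite lerDr a0.
by rewrite tri orbT.
Qed.

HB.instance Definition _ := Choice.copy (lexicographic Y etaX) (X * Y)%type.

HB.instance Definition _ := @isMetric.Build R (lexicographic Y etaX)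
  lexicographic_dist distxx dist_positivity dist_sym dist_triangle.

End LexicographicMetric.

Lemma mdist_lexicographicE (R : realType) (X Y : metricType R)
    (etaX : (0 < nearness X)%E) (p q : lexicographic Y etaX) :
  mdist p q = lexicographic_dist p q.
Proof. by []. Qed.

(* Main.v *)
Require Import Defs.
From mathcomp Require Import all_boot all_order all_algebra.
From mathcomp Require Import all_classical all_reals all_analysis.

Import Order.TTheory GRing.Theory Num.Theory.

(** Since the nearness of X is positive, points of the lexicographic space lying
    over distinct points of X are uniformly apart, while inside one fibre
    {x} * Y the metric is that of Y truncated at the positive radius
    2 * nearness_at x.  Truncation does not change small balls, so the
    lexicographic space is, topologically, a disjoint sum of copies of Y indexed
    by the discrete space X.  Concretely, every small ball lies in one fibre and
    projects into the ball of Y of the same radius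
    ([lexicographic_ball_fiber]), which makes both projections continuous, and
    each inclusion Y -> {x} * Y is continuous because truncation only shrinks
    distances.

    If the lexicographic space is compact, its images X and Y under the two
    projections (onto, as both factors are inhabited) are compact, and a compact
    discrete space is finite ([compact_discrete_finite]).  Conversely, over a
    finite X the space is a finite union of the fibres, which are continuous
    images of the compact space Y. *)

Local Open Scope classical_set_scope.
Local Open Scope ring_scope.

(** In an infinite space the cofinite sets form a proper filter, and this filter
    cannot cluster at an isolated point x, since the complement of x is
    cofinite. *)
Lemma compact_discrete_finite (T : topologicalType) :
  (forall x : T, nbhs x [set x]) -> compact [set: T] -> finite_set [set: T].
Proof.
move=> Tdiscrete Tcompact; apply: contrapT => Tinfinite.
pose cofinite : set_system T := [set A | finite_set (~` A)].
have cofinite_proper : ProperFilter cofinite.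
  split; first by rewrite /cofinite /= setC0.
  split; first by rewrite /cofinite /= setCT; exact: finite_set0.
  - by move=> A B Afin Bfin; rewrite /cofinite /= setCI finite_setU.
  - by move=> A B /subsetC AB; exact: sub_finite_set.
have [x [_ x_cluster]] : [set: T] `&` cluster cofinite !=set0.
  by apply: Tcompact; rewrite /cofinite /= setCT; exact: finite_set0.
have xC_cofinite : cofinite (~` [set x]).
  by rewrite /cofinite /= setCK; exact: finite_set1.
by have [y [/= yx]] := x_cluster _ _ xC_cofinite (Tdiscrete x).
Qed.

Lemma mdist_continuous (R : realType) (M N : metricType R) (f : M -> N) :
  (forall p e, 0 < e ->
     exists2 d, 0 < d & forall q, mdist p q < d -> mdist (f p) (f q) < e) ->
  continuous f.
Proof.
move=> f_cont p; apply/cvg_ballP => e /(f_cont p)[d d0 fd].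
by apply/nbhs_ballP; exists d => // q; rewrite !ballEmdist /=; exact: fd.
Qed.

Section Lexicographic.
Context {R : realType} {X : metricType R} (etaX : (0 < nearness X)%E).

(** The nearness of a point is +oo when X is a singleton, so a real radius below
    it has to be chosen. *)
Lemma nearness_at_radius (x : X) :
  exists2 e : R, 0 < e & (e%:E <= nearness_at x)%E.
Proof.
have := nearness_at_gt0 x etaX; case: (nearness_at x) => [r||]//.
- by rewrite lte_fin => r0; exists r.
- by move=> _; exists 1; rewrite ?leey.
Qed.

Lemma lt_nearness_at_eq (x y : X) (e : R) :
  (e%:E <= nearness_at x)%E -> mdist x y < e -> x = y.
Proof.
move=> ex xy; apply/eqP; apply: contraTT xy => xy.
by rewrite -leNgt -lee_fin (le_trans ex)// nearness_at_le.
Qed.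

Lemma nearness_gt0_discrete (x : X) : nbhs x [set x].
Proof.
have [e e0 ex] := nearness_at_radius x.
apply/nbhs_ballP; exists e => //= y; rewrite ballEmdist /= => xy.
by rewrite (lt_nearness_at_eq _ _ _ ex xy).
Qed.

Context {Y : metricType R}.
Local Notation L := (lexicographic Y etaX).

Lemma lexicographic_ball_fiber (p q : L) (e : R) :
  (e%:E <= nearness_at p.1)%E -> mdist p q < e ->
  p.1 = q.1 /\ mdist p.2 q.2 < e.
Proof.
move=> ep; rewrite mdist_lexicographicE /lexicographic_dist.
case: eqVneq => [pq1|pq1 pqe]; last first.
  by rewrite (lt_nearness_at_eq _ _ _ ep pqe) eqxx in pq1.
move=> pqe; split=> //; move: ep (nearness_at_gt0 p.1 etaX) pqe.
case: (nearness_at p.1) => [r||]//; last first.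
  by move=> _ _; rewrite gt0_muley ?lte_fin// min_r ?leey.
rewrite lee_fin lte_fin -EFinM -EFin_min /= => er r0.
rewrite gt_min => /orP[|//].
(* the truncation radius 2 r is at least e, so it is not the minimum *)
by rewrite ltNge (le_trans er)// mulr_natl mulr2n lerDl ltW.
Qed.

Lemma continuous_lexicographic_fst : continuous (fst : L -> X).
Proof.
apply: mdist_continuous => p e e0; have [r r0 rp] := nearness_at_radius p.1.
exists r => // q pq.
by have [-> _] := lexicographic_ball_fiber _ _ _ rp pq; rewrite mdistxx.
Qed.

Lemma continuous_lexicographic_snd : continuous (snd : L -> Y).
Proof.
apply: mdist_continuous => p e e0; have [r r0 rp] := nearness_at_radius p.1.
exists (Num.min e r) => [|q pq]; first by rewrite lt_min e0.
have mp : ((Num.min e r)%:E <= nearness_at p.1)%E.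
  by apply: le_trans rp; rewrite lee_fin ge_min lexx orbT.
have [_ /lt_le_trans] := lexicographic_ball_fiber _ _ _ mp pq.
by apply; rewrite ge_min lexx.
Qed.

Lemma lexicographic_fiber_le (x : X) (y y' : Y) :
  mdist ((x, y) : L) (x, y') <= mdist y y'.
Proof.
rewrite mdist_lexicographicE /lexicographic_dist /= eqxx.
have := nearness_at_gt0 x etaX; case: (nearness_at x) => [r||]// _.
- by rewrite -EFinM -EFin_min /= ge_min lexx orbT.
- by rewrite gt0_muley ?lte_fin// min_r ?leey.
Qed.

Lemma continuous_lexicographic_fiber (x : X) :
  continuous (fun y : Y => (x, y) : L).
Proof.
apply: mdist_continuous => y e e0; exists e => // y'.
exact: le_lt_trans (lexicographic_fiber_le x y y').
Qed.

End Lexicographic.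

Theorem theorem10 (R : realType) (X Y : metricType R)
    (X0 : [set: X] !=set0) (Y0 : [set: Y] !=set0)
    (etaX : (0 < nearness X)%E) :
  compact [set: lexicographic Y etaX] <->
  finite_set [set: X] /\ compact [set: Y].
Proof.
split=> [Lcompact|[Xfinite Ycompact]].
- have [[x _] [y _]] := (X0, Y0).
  have fst_onto : (fst : lexicographic Y etaX -> X) @` setT = setT.
    by rewrite eqEsubset; split=> // x' _; exists (x', y).
  have snd_onto : (snd : lexicographic Y etaX -> Y) @` setT = setT.
    by rewrite eqEsubset; split=> // y' _; exists (x, y').
  split.
  + apply: compact_discrete_finite; first exact: nearness_gt0_discrete.
    rewrite -fst_onto; apply: continuous_compact Lcompact.
    exact/continuous_subspaceT/continuous_lexicographic_fst.
  + rewrite -snd_onto; apply: continuous_compact Lcompact.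
    exact/continuous_subspaceT/continuous_lexicographic_snd.
- have -> : [set: lexicographic Y etaX] =
      \bigcup_(x in [set: X]) ((fun y => (x, y)) @` [set: Y]).
    by rewrite eqEsubset; split=> // -[x y] _; exists x => //; exists y.
  rewrite -fsbig_setU//; apply: big_rec; first exact: compact0.
  move=> x A _; apply: compactU; apply: continuous_compact Ycompact.
  exact/continuous_subspaceT/continuous_lexicographic_fiber.
Qed.
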